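(* Under the setting and standing assumptions of the context, in particular if $\gamma\delta_h\le c_0<4$, there is $\alpha_{\mathcal B}>0$, independent of $h$, such that $$\mathcal A_h((\mu,v),(\mu,v))\ge\alpha_{\mathcal B}\,|\!|\!|(\mu,v)|\!|\!|_{\mathcal B}^2\qquad\text{for all }(\mu,v)\in\tilde{\mathcal V}_{\Gamma_h}.$$
   Context: Geometry. $\Omega\subset\mathbb R^3$ is a bounded domain with smooth, connected boundary $\Gamma$. For each mesh size $0<h\le h_0$, $\Omega_h\subset\Omega$ is a bounded polyhedral domain with connected boundary $\Gamma_h\subset\overline\Omega$, with a conforming, shape-regular, quasiuniform triangulation $\mathcal T_h$ (uniformly in $h$) into flat triangular panels of maximum diameter $h$; $\mathbf n_h$ is the outward unit normal to $\Omega_h$, constant on each open panel. For almost every $x\in\Gamma_h$ there is $\rho(x)\ge 0$ with $p(x):=x+\rho(x)\mathbf n_h(x)\in\Gamma$, $0\le\rho(x)\le\delta_h:=\|\rho\|_{L^\infty(\Gamma_h)}\le C_\rho h$ ($C_\rho$ independent of $h$), and the segment from $x$ to $p(x)$ lies in $\overline\Omega$. The number $h_0$ is chosen so that $C_\rho h_0$ lies within the width of a fixed tubular neighbourhood of $\Gamma$. Surface Sobolev norms on $\Gamma_h$ are uniformly (in $h$) equivalent under Lipschitz parametrisations, and the area $|\Gamma_h|$ is uniformly bounded above and below. Operators on $\Gamma_h$. With $G_0(x,y)=\frac{1}{4\pi|x-y|}$: $(V\phi)(x)=\int_{\Gamma_h}G_0(x,y)\phi(y)\,dS(y)$; $(K\phi)(x)=\mathrm{p.v.}\int_{\Gamma_h}\partial_{\mathbf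 n_h(y)}G_0(x,y)\phi(y)\,dS(y)$ (both extended to $H^{-1/2}(\Gamma_h)$, resp. $H^{1/2}(\Gamma_h)$); $K'$ is the adjoint of $K$; $D\phi$ is minus the weak interior Neumann trace of the double-layer potential $x\mapsto\int_{\Gamma_h}\partial_{\mathbf n_h(y)}G_0(x,y)\phi(y)\,dS(y)$. $\langle\cdot,\cdot\rangle_{\Gamma_h}$ is the $H^{-1/2}$–$H^{1/2}$ duality pairing (in either order), agreeing with the $L^2(\Gamma_h)$ inner product on $L^2$ functions; $\|\cdot\|_{\Gamma_h}$ is the $L^2(\Gamma_h)$ norm. $D$ is symmetric, nonnegative and its kernel consists of the globally constant functions. Uniform operator bounds, with constants independent of $h$: $V:H^{-1/2}\to H^{1/2}$, $D:H^{1/2}\to H^{-1/2}$, $K:H^{1/2}\to H^{1/2}$, $K':H^{-1/2}\to H^{-1/2}$ are bounded on $\Gamma_h$; $\langle V\mu,\mu\rangle_{\Gamma_h}\ge c_V\|\mu\|^2_{H^{-1/2}(\Gamma_h)}$ for all $\mu\in H^{-1/2}(\Gamma_h)$; $\langle Dw,w\rangle_{\Gamma_h}\ge c_2^D\|w\|_{H^{1/2}(\Gamma_h)}^2$ for all $w\in H^{1/2}(\Gamma_h)$ with $\int_{\Gamma_h}w\,dS=0$. Penalty. $\gamma>0$ is a scalar (depending on $h$) with $c_\gamma^-h^{-1}\le\gamma\le c_\gamma^+h^{-1}$ and $\gamma\delta_h\le c_0<4$, where $c_\gamma^\pm,c_0>0$ are fixed. Overlap of normal segments (part of the standing assumptions).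 With $U_{\delta}:=\{y\in\Omega:\operatorname{dist}(y,\Gamma)<\delta\}$, there is $C_{\mathrm{ray}}$ independent of $h$ with $\sum_{T\in\mathcal T_h}\int_T\int_0^{\rho(x)}|f(x+t\mathbf n_h)|^2\,dt\,dS(x)\le C_{\mathrm{ray}}\|f\|_{L^2(U_{\delta_h})}^2$ for all $f\in L^2(U_{\delta_h})$. Forms. On $\tilde{\mathcal V}_{\Gamma_h}:=L^2(\Gamma_h)\times H^{1/2}(\Gamma_h)$ (flux first, Dirichlet trace second), $$\tilde{\mathcal C}_{\Gamma_h}[(\lambda,w),(\mu,v)]:=-\langle Kw,\mu\rangle_{\Gamma_h}+\langle V\lambda,\mu\rangle_{\Gamma_h}+\langle K'\lambda,v\rangle_{\Gamma_h}+\langle Dw,v\rangle_{\Gamma_h},$$ $$\mathcal B_D[(\lambda,w),(\mu,v)]:=-\tfrac12\langle\lambda,v\rangle_{\Gamma_h}+\tfrac12\langle w,\mu\rangle_{\Gamma_h}+\langle\gamma(w+\rho\lambda),v\rangle_{\Gamma_h}+\langle\rho\lambda,\mu\rangle_{\Gamma_h},$$ $$\mathcal A_h((\lambda,w),(\mu,v)):=\tilde{\mathcal C}_{\Gamma_h}[(\lambda,w),(\mu,v)]+\mathcal B_D[(\lambda,w),(\mu,v)].$$ Norm. $|\!|\!|(\mu,v)|\!|\!|_{\mathcal B}:=\|\mu\|_{H^{-1/2}(\Gamma_h)}+\|v\|_{H^{1/2}(\Gamma_h)}+\|\gamma^{1/2}v\|_{\Gamma_h}+\|\rho^{1/2}\mu\|_{\Gamma_h}$.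 *)

(* Defs.v *)
From HB Require Import structures.
From mathcomp Require Import all_boot all_order all_algebra.
From mathcomp Require Import all_classical all_reals all_analysis.
From mathcomp Require Import measurable_realfun.

Set Implicit Arguments.
Unset Strict Implicit.
Unset Printing Implicit Defensive.

Import Order.TTheory GRing.Theory Num.Theory.
Import numFieldNormedType.Exports.

Local Open Scope classical_set_scope.
Local Open Scope ring_scope.

(* Points of R^3 are triples, for which the library has the product topology,
   normed module and product sigma-algebra.  The library norm on a product is
   the max norm, so Euclidean quantities are defined by hand. *)
Notation pt R := (R * R * R)%type.
Notation lebesgue2 R := (@lebesgue_measure R \x @lebesgue_measure R)%E.
Notation lebesgue3 R :=
  ((@lebesgue_measure R \x @lebesgue_measure R) \x @lebesgue_measure R)%E.

Section Euclidean.
Context {R : realType}.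
Implicit Types (x y : pt R) (A : set (pt R)) (f : pt R -> R).

Definition dot x y : R := x.1.1 * y.1.1 + x.1.2 * y.1.2 + x.2 * y.2.

Definition cross x y : pt R :=
  (x.1.2 * y.2 - x.2 * y.1.2, x.2 * y.1.1 - x.1.1 * y.2,
   x.1.1 * y.1.2 - x.1.2 * y.1.1).

Definition eucl_norm x : R := Num.sqrt (dot x x).

Lemma eucl_norm_ge0 x : 0 <= eucl_norm x. Proof. exact: sqrtr_ge0. Qed.

Definition eucl_dist x y : R := eucl_norm (x - y).

Definition eucl_dist2 (u v : R * R) : R :=
  Num.sqrt ((u.1 - v.1) ^+ 2 + (u.2 - v.2) ^+ 2).

Definition distset x A : R := inf [set eucl_dist x z | z in A].

Definition segment x y : set (pt R) :=
  [set x + t *: (y - x) | t in `[0, 1]%classic].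

Definition basis_vec (i : 'I_3) : pt R :=
  ((i == 0 :> nat)%:R, (i == 1%N :> nat)%:R, (i == 2%N :> nat)%:R).

Definition partial (i : 'I_3) f : pt R -> R := fun x => 'D_(basis_vec i) f x.

Definition grad f x : pt R :=
  (partial (inord 0) f x, partial (inord 1) f x, partial (inord 2) f x).

Definition laplacian f x : R := \sum_(i < 3) partial i (partial i f) x.

(* C^infinity on A; only used for open A. *)
Definition smooth_on A f : Prop :=
  forall (s : seq 'I_3) x, A x ->
    {for x, continuous (foldr partial f s)} /\
    forall i : 'I_3, derivable (foldr partial f s) x (basis_vec i).

Definition domain A : Prop := [/\ open A, connected A & A !=set0].

Definition bdry A : set (pt R) := closure A `\` A^°.

Definition defining_function A z f : Prop :=
  [/\ smooth_on setT f, f z = 0, grad f z != 0 &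
      \forall y \near z, A y <-> f y < 0].

Definition smooth_boundary A : Prop :=
  forall z, bdry A z -> exists f, defining_function A z f.

Definition outward_normal A z (nu : pt R) : Prop :=
  exists f, defining_function A z f /\
    nu = (eucl_norm (grad f z))^-1 *: grad f z.

(* (z, t) |-> z + t nu(z) is a diffeomorphism from bdry A * ]-tau, tau[ onto
   the tau-neighbourhood of bdry A, with inverse y |-> (q y, s y). *)
Definition tubular_width A (tau : R) : Prop :=
  0 < tau /\
  exists (nu q : pt R -> pt R) (s : pt R -> R),
    let N := [set y | exists2 z, bdry A z & eucl_dist y z < tau] in
    [/\ forall z, bdry A z -> outward_normal A z (nu z),
        [/\ smooth_on N (fun y => (q y).1.1), smooth_on N (fun y => (q y).1.2),
            smooth_on N (fun y => (q y).2) & smooth_on N s],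
        forall y, N y ->
          [/\ bdry A (q y), `|s y| < tau & y = q y + s y *: nu (q y)] &
        forall z t, bdry A z -> `|t| < tau ->
          q (z + t *: nu z) = z /\ s (z + t *: nu z) = t].

End Euclidean.

Section Panels.
Context {R : realType}.

(* A triangle is given by its vertices, ordered so that cross (b - a) (c - a)
   is the outward normal direction (see [triangulates]). *)
Definition panel : Type := (pt R * pt R * pt R)%type.

Implicit Types (T : panel) (m : seq panel).

Definition vertices T : set (pt R) := [set T.1.1; T.1.2; T.2].

Definition param T (u : R * R) : pt R :=
  T.1.1 + u.1 *: (T.1.2 - T.1.1) + u.2 *: (T.2 - T.1.1).

Definition ref_triangle : set (R * R) :=
  [set u | (0 <= u.1) && (0 <= u.2) && (u.1 + u.2 <= 1)].

Definition cpanel T : set (pt R) := param T @` ref_triangle.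

Definition opanel T : set (pt R) :=
  param T @` [set u | [/\ 0 < u.1, 0 < u.2 & u.1 + u.2 < 1]].

Definition area_vec T : pt R := cross (T.1.2 - T.1.1) (T.2 - T.1.1).

Definition parea T : R := eucl_norm (area_vec T) / 2.

Definition pnormal T : pt R := (eucl_norm (area_vec T))^-1 *: area_vec T.

Definition pdiam T : R :=
  sup [set eucl_dist p.1 p.2 | p in cpanel T `*` cpanel T].

Definition pinradius T : R :=
  2 * parea T /
  (eucl_dist T.1.1 T.1.2 + eucl_dist T.1.2 T.2 + eucl_dist T.2 T.1.1).

Lemma measurable_ref_triangle : measurable ref_triangle.
Proof.
have -> : ref_triangle = [set: R * R] `&` (fun u : R * R =>
    (0 <= u.1) && (0 <= u.2) && (u.1 + u.2 <= 1)) @^-1` [set true].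
  by rewrite setTI; apply/seteqP; split.
suff H : measurable_fun [set: R * R] (fun u : R * R =>
    (0 <= u.1) && (0 <= u.2) && (u.1 + u.2 <= 1)) by exact: H.
by apply: measurable_and; [apply: measurable_and|];
  apply: measurable_fun_ler => //; apply: measurable_funD.
Qed.

Lemma measurable_param T : measurable_fun [set: R * R] (param T).
Proof.
have H (a b c : R) : measurable_fun [set: R * R]
    (fun u : R * R => a + u.1 * b + u.2 * c).
  by apply: measurable_funD; [apply: measurable_funD => //|];
    apply: measurable_funM.
by apply: measurable_fun_pair => /=; [apply: measurable_fun_pair => /=|];
  exact: H.
Qed.

Definition param_image T (A : set (pt R)) : \bar R :=
  pushforward (mrestr (lebesgue2 R) measurable_ref_triangle) (param T) A.

HB.instance Definition _ T := Measure.copy (param_image T)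
  (measure_function_pushforward__canonical__measure_function_Measure
     (mrestr (lebesgue2 R) measurable_ref_triangle) (measurable_param T)).

(* The factor is the Jacobian of [param T]. *)
Definition panel_measure T : {measure set (pt R) -> \bar R} :=
  mscale (NngNum (eucl_norm_ge0 (area_vec T))) (param_image T).

Definition surface_measure m : {measure set (pt R) -> \bar R} :=
  msum (fun k => panel_measure (nth 0 m k)) (size m).

Definition surface m : set (pt R) := [set x | exists2 T, T \in m & cpanel T x].

(* The unit normal n_h: pnormal T on each open panel T (open panels are
   disjoint), and 0 on the null set of panel edges. *)
Definition normal m (x : pt R) : pt R :=
  \sum_(T <- m) \1_(opanel T) x *: pnormal T.

Definition conforming m : Prop :=
  forall T T', T \in m -> T' \in m -> T != T' ->
  [\/ cpanel T `&` cpanel T' = set0,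
      exists2 a, (vertices T `&` vertices T') a &
        cpanel T `&` cpanel T' = [set a] |
      exists a b, [/\ a != b, (vertices T `&` vertices T') a,
        (vertices T `&` vertices T') b &
        cpanel T `&` cpanel T' = segment a b]].

(* [Omh] is the polyhedral domain whose boundary is triangulated by [m]; the
   last clause says that pnormal T is the unit normal pointing out of [Omh]. *)
Definition triangulates (Omh : set (pt R)) m : Prop :=
  [/\ bdry Omh = surface m, uniq m, forall T, T \in m -> 0 < parea T,
      conforming m &
      forall T x, T \in m -> opanel T x -> \forall t \near 0^'+,
        Omh (x - t *: pnormal T) /\ ~ closure Omh (x + t *: pnormal T)].

Definition mesh_size m : R := \big[Num.max/0]_(T <- m) pdiam T.

Definition shape_regular (kappa : R) m : Prop :=
  forall T, T \in m -> pdiam T <= kappa * pinradius T.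

Definition quasiuniform (q : R) m : Prop :=
  forall T, T \in m -> mesh_size m <= q * pdiam T.

End Panels.
Arguments panel : clear implicits.

Section FractionalNorms.
Context {d} {X : measurableType d} {R : realType}.
Variables (mu : {measure set X -> \bar R}) (dist : X -> X -> R).
Implicit Types (phi w v : X -> R) (l : (X -> R) -> R).

Definition L2norm phi : R := fine ('N[mu]_(2%:E) [EFin \o phi]).

(* The squared Sobolev-Slobodeckij seminorm of order 1/2 on a 2-dimensional
   set: the exponent 3 is 2 + 2 * (1/2). *)
Definition slobodeckij2 v : \bar R :=
  (\int[mu]_x \int[mu]_y ((v x - v y) ^+ 2 / dist x y ^+ 3)%:E)%E.

Definition in_Hhalf v : Prop :=
  v \in Lfun mu 2%:E /\ (slobodeckij2 v < +oo)%E.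

Definition Hhalf_norm v : R :=
  Num.sqrt (L2norm v ^+ 2 + fine (slobodeckij2 v)).

(* H^{-1/2} is the dual of H^{1/2}: its elements are represented by functionals
   on functions, of which only the values on H^{1/2} are relevant.  The duality
   pairing of l and v is the application [l v]. *)
Definition in_Hmhalf l : Prop :=
  (forall (a : R) w v, in_Hhalf w -> in_Hhalf v ->
     l (a \*o w \+ v) = a * l w + l v) /\
  exists C : R, forall v, in_Hhalf v -> `|l v| <= C * Hhalf_norm v.

Definition Hmhalf_norm l : R :=
  sup [set `|l v| | v in [set v | in_Hhalf v /\ Hhalf_norm v <= 1]].

(* The embedding of L^2 into H^{-1/2}. *)
Definition Lpair phi v : R := \int[mu]_x (phi x * v x).

End FractionalNorms.

Section UniformCharts.
Context {R : realType}.

(* [measurableTypeR R] is R with the sigma-algebra on which [lebesgue_measure]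
   is declared. *)
Definition unit_square : set (measurableTypeR R * measurableTypeR R) :=
  `]0%R, 1%R[%classic `*` `]0%R, 1%R[%classic.

Lemma measurable_unit_square : measurable unit_square.
Proof. by apply: measurableX; exact: measurable_itv. Qed.

Definition square_measure :
    {measure set (measurableTypeR R * measurableTypeR R) -> \bar R} :=
  mrestr (lebesgue2 R) measurable_unit_square.

(* The surface of [m] is covered by [n] charts, bi-Lipschitz with constant [L]
   on the open unit square, in which the L^2 and H^{1/2} norms are computed up
   to the constant [C]. *)
Definition lipschitz_charts (n : nat) (L C : R) (m : seq (panel R)) : Prop :=
  exists chi : 'I_n -> R * R -> pt R,
  [/\ surface m = \bigcup_i (chi i @` unit_square),
      forall i u v, unit_square u -> unit_square v ->
        eucl_dist2 u v <= L * eucl_dist (chi i u) (chi i v) /\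
        eucl_dist (chi i u) (chi i v) <= L * eucl_dist2 u v &
      forall v : pt R -> R, measurable_fun setT v ->
        let mu := surface_measure m in
        let l2 := ('N[mu]_(2%:E) [EFin \o v] ^+ 2)%E in
        let l2' := (\sum_(i < n)
          'N[square_measure]_(2%:E) [EFin \o v \o chi i] ^+ 2)%E in
        let s := (l2 + slobodeckij2 mu eucl_dist v)%E in
        let s' := (l2' +
          \sum_(i < n) slobodeckij2 square_measure eucl_dist2 (v \o chi i))%E in
        [/\ (l2 <= C%:E * l2')%E, (l2' <= C%:E * l2)%E,
            (s <= C%:E * s')%E & (s' <= C%:E * s)%E]].

End UniformCharts.

Section Setting.
Context {R : realType}.
Variables (Om : set (pt R)) (m : seq (panel R)) (rho : pt R -> R).

Definition delta : R := fine ('N[surface_measure m]_(+oo%E) [EFin \o rho]).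

Definition normal_projection : Prop :=
  rho \in Lfun (surface_measure m) +oo%E /\
  {ae surface_measure m, forall x,
    [/\ 0 <= rho x <= delta, bdry Om (x + rho x *: normal m x) &
        segment x (x + rho x *: normal m x) `<=` closure Om]}.

Definition collar (r : R) : set (pt R) :=
  [set y | Om y /\ distset y (bdry Om) < r].

(* Functions on the collar are extended by zero. *)
Definition ray_overlap (Cray : R) : Prop :=
  forall f : pt R -> R, measurable_fun (collar delta) f ->
  (\int[lebesgue3 R]_(y in collar delta) (f y ^+ 2)%:E < +oo)%E ->
  (\sum_(T <- m) \int[panel_measure T]_x
     \int[@lebesgue_measure R]_(t in `[0%R, rho x])
       (((f \_ (collar delta)) (x + t *: pnormal T)) ^+ 2)%:E
   <= Cray%:E * \int[lebesgue3 R]_(y in collar delta) (f y ^+ 2)%:E)%E.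

End Setting.

Section Operators.
Context {R : realType}.
Variable m : seq (panel R).
Implicit Types (w v phi u : pt R -> R) (l : (pt R -> R) -> R).

Local Notation mu := (surface_measure m).

Definition L2 phi : Prop := phi \in Lfun mu 2%:E.
Definition Hhalf w : Prop := in_Hhalf mu eucl_dist w.
Definition Hmhalf l : Prop := in_Hmhalf mu eucl_dist l.
Definition normH w : R := Hhalf_norm mu eucl_dist w.
Definition normHm l : R := Hmhalf_norm mu eucl_dist l.

Definition G0 (x y : pt R) : R := (4 * pi * eucl_dist x y)^-1.

Definition dnG0 (x y : pt R) : R := 'D_(normal m y) (G0 x) y.

Definition single_layer phi : pt R -> R := fun x => \int[mu]_y (G0 x y * phi y).

Definition double_layer w : pt R -> R := fun x => \int[mu]_y (dnG0 x y * w y).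

Definition opK w : pt R -> R := fun x =>
  lim ((\int[mu]_(y in [set y | e < eucl_dist x y]) (dnG0 x y * w y))
    @[e --> (0:R)^'+]).

(* The adjoint K'. *)
Definition opK' l : (pt R -> R) -> R := fun v => l (opK v).

Definition bounded_K (C : R) : Prop :=
  [/\ forall w, Hhalf w -> Hhalf (opK w),
      forall (a : R) w v, Hhalf w -> Hhalf v ->
        {ae mu, forall x, opK (a \*o w \+ v) x = a * opK w x + opK v x} &
      forall w, Hhalf w -> normH (opK w) <= C * normH w].

Definition bounded_K' (C : R) : Prop :=
  forall l, Hmhalf l -> Hmhalf (opK' l) /\ normHm (opK' l) <= C * normHm l.

Definition bounded_V (V : ((pt R -> R) -> R) -> pt R -> R) (C : R) : Prop :=
  [/\ forall l, Hmhalf l -> Hhalf (V l),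
      forall (a : R) l l', Hmhalf l -> Hmhalf l' ->
        {ae mu, forall x, V (fun v => a * l v + l' v) x = a * V l x + V l' x} &
      forall l, Hmhalf l -> normH (V l) <= C * normHm l].

(* V agrees with the single layer integral on L^2.  Together with [bounded_V]
   this determines it on H^{-1/2}, in which L^2 is dense. *)
Definition extends_single_layer (V : ((pt R -> R) -> R) -> pt R -> R) : Prop :=
  forall phi, L2 phi ->
    {ae mu, forall x, V (Lpair mu phi) x = single_layer phi x}.

Definition bounded_D (D : (pt R -> R) -> (pt R -> R) -> R) (C : R) : Prop :=
  [/\ forall w, Hhalf w -> Hmhalf (D w),
      forall (a : R) w w' v, Hhalf w -> Hhalf w' -> Hhalf v ->
        D (a \*o w \+ w') v = a * D w v + D w' v &
      forall w, Hhalf w -> normHm (D w) <= C * normH w].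

(* [l] is the weak Neumann trace of the harmonic function u in H^1(Omh), by
   Green's formula.  Testing with smooth functions on R^3 is enough: their
   restrictions are dense in H^1(Omh), and their traces in H^{1/2}. *)
Definition weak_neumann_trace (Omh : set (pt R)) u l : Prop :=
  [/\ smooth_on Omh u, forall x, Omh x -> laplacian u x = 0,
      (\int[lebesgue3 R]_(x in Omh)
         (u x ^+ 2 + dot (grad u x) (grad u x))%:E < +oo)%E,
      Hmhalf l &
      forall E : pt R -> R, smooth_on setT E ->
        l E = \int[lebesgue3 R]_(x in Omh) dot (grad u x) (grad E x)].

Definition is_hypersingular (Omh : set (pt R))
    (D : (pt R -> R) -> (pt R -> R) -> R) : Prop :=
  forall w, Hhalf w ->
    weak_neumann_trace Omh (double_layer w) (fun v => - D w v).

Definition symmetric_D (D : (pt R -> R) -> (pt R -> R) -> R) : Prop :=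
  forall w v, Hhalf w -> Hhalf v -> D w v = D v w.

Definition nonneg_D (D : (pt R -> R) -> (pt R -> R) -> R) : Prop :=
  forall w, Hhalf w -> 0 <= D w w.

Definition kernel_D (D : (pt R -> R) -> (pt R -> R) -> R) : Prop :=
  forall w, Hhalf w ->
    (forall v, Hhalf v -> D w v = 0) <->
    (exists c : R, {ae mu, forall x, w x = c}).

Section Forms.
Variables (V : ((pt R -> R) -> R) -> pt R -> R)
          (D : (pt R -> R) -> (pt R -> R) -> R) (gamma : R) (rho : pt R -> R).

(* Pairs are (flux, Dirichlet trace). *)
Definition in_Vtilde (p : (pt R -> R) * (pt R -> R)) : Prop :=
  L2 p.1 /\ Hhalf p.2.

Definition formC (p q : (pt R -> R) * (pt R -> R)) : R :=
  let: (lam, w) := p in let: (phi, v) := q in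
  - Lpair mu phi (opK w) + Lpair mu phi (V (Lpair mu lam))
  + opK' (Lpair mu lam) v + D w v.

Definition formBD (p q : (pt R -> R) * (pt R -> R)) : R :=
  let: (lam, w) := p in let: (phi, v) := q in
  - 2^-1 * Lpair mu lam v + 2^-1 * Lpair mu w phi
  + Lpair mu (fun x => gamma * (w x + rho x * lam x)) v
  + Lpair mu (fun x => rho x * lam x) phi.

Definition formA p q : R := formC p q + formBD p q.

Definition normB (p : (pt R -> R) * (pt R -> R)) : R :=
  normHm (Lpair mu p.1) + normH p.2
  + L2norm mu (fun x => Num.sqrt gamma * p.2 x)
  + L2norm mu (fun x => Num.sqrt (rho x) * p.1 x).

End Forms.
End Operators.

(* Main.v *)
Require Import Defs.
From HB Require Import structures.
From mathcomp Require Import all_boot all_order all_algebra.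
From mathcomp Require Import all_classical all_reals all_analysis.
From mathcomp Require Import measurable_realfun lra.

Set Implicit Arguments.
Unset Strict Implicit.
Unset Printing Implicit Defensive.

Import Order.TTheory GRing.Theory Num.Theory.
Import numFieldNormedType.Exports.

Local Open Scope classical_set_scope.
Local Open Scope ring_scope.

(** On the diagonal the terms with K and K' cancel, because K' is the adjoint
    of K, and the two skew terms with the factor 1/2 cancel, because the L^2
    pairing is symmetric.  With p = (lam, w) what is left is

      A_h(p, p) = <V lam, lam> + <D w, w>
                  + int (gamma w^2 + gamma rho lam w + rho lam^2).

    The first term controls the H^{-1/2} norm of lam by the ellipticity of V.

    The integrand of the last term is a quadratic form in
    a = gamma^{1/2} w and b = rho^{1/2} lam, namely a^2 + s a b + b^2 with
    s = (gamma rho)^{1/2} <= c0^{1/2} < 2 almost everywhere.  It is therefore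
    at least (1 - c0^{1/2} / 2) (a^2 + b^2) ([damped_young], integrated in
    [penalty_coercive]), with a positive factor exactly because c0 < 4.

    The operator D is elliptic only on functions of mean zero.  Subtracting the
    mean of w changes neither <D w, w>, as D is symmetric and annihilates
    constants, nor the Slobodeckij seminorm of w.  So <D w, w> controls that
    seminorm, and the H^{1/2} norm of w is controlled once its L^2 norm is added
    ([Hhalf_coercive_modulo_L2]).  The penalty term supplies that L^2 norm,
    since gamma >= cgm / h >= cgm / h0.

    The constants produced in this way depend on cV, cD, c0, cgm and h0 only;
    [coercivity_constant] combines them into alpha. *)

(** * Integrals, L^2 pairings and the penalty form *)

Section Integration.
Context {d} {T : measurableType d} {R : realType}.
Context (mu : {measure set T -> \bar R}).
Implicit Types (f g r : T -> R) (dist : T -> T -> R).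

Lemma Lfun_measurable p f : f \in Lfun mu p -> measurable_fun setT f.
Proof. by move=> /andP[/[!inE]]. Qed.

Lemma integrable_EFinZl (a : R) f : mu.-integrable setT (EFin \o f) ->
  mu.-integrable setT (EFin \o (fun x => a * f x)).
Proof.
move=> If; have := integrableZl measurableT a If.
by apply: eq_integrable => // x _ /=; rewrite EFinM.
Qed.

Lemma integrable_EFinD f g :
  mu.-integrable setT (EFin \o f) -> mu.-integrable setT (EFin \o g) ->
  mu.-integrable setT (EFin \o (fun x => f x + g x)).
Proof.
move=> If Ig; have := integrableD measurableT If Ig.
by apply: eq_integrable => // x _ /=; rewrite EFinD.
Qed.

Lemma L2_prod_integrable f g : f \in Lfun mu 2%:E -> g \in Lfun mu 2%:E ->
  mu.-integrable setT (EFin \o (fun x => f x * g x)).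
Proof. by move=> f2 g2; apply/Lfun1_integrable/Lfun2_mul_Lfun1. Qed.

Lemma ae_le_Rintegral f g :
  mu.-integrable setT (EFin \o f) -> mu.-integrable setT (EFin \o g) ->
  {ae mu, forall x, f x <= g x} -> \int[mu]_x f x <= \int[mu]_x g x.
Proof.
move=> If Ig fg; rewrite -subr_ge0 -RintegralB//.
have /measurable_EFinP mf := measurable_int _ If.
have /measurable_EFinP mg := measurable_int _ Ig.
rewrite (_ : \int[mu]_x (g x - f x) = \int[mu]_x `|g x - f x|).
  exact: Rintegral_ge0.
congr fine; apply: ae_eq_integral => //.
- by apply/measurable_EFinP; exact: measurable_funB.
- by apply/measurable_EFinP/measurableT_comp => //; exact: measurable_funB.
- by apply: filterS fg => x fgx _; rewrite ger0_norm// subr_ge0.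
Qed.

(** The distance function rho is bounded only almost everywhere, so a pointwise
    domination would not apply to the weighted integrals of the penalty. *)
Lemma ae_bounded_integrable r f (b : R) : measurable_fun setT r ->
  {ae mu, forall x, `|r x| <= b} -> mu.-integrable setT (EFin \o f) ->
  mu.-integrable setT (EFin \o (fun x => r x * f x)).
Proof.
move=> mr rb If.
have /measurable_EFinP mf := measurable_int _ If.
have [_ bf_fin] := integrableP _ _ _ (integrableZl measurableT b If).
apply/integrableP; split; first by apply/measurable_EFinP; exact: measurable_funM.
apply: le_lt_trans bf_fin; apply: ae_ge0_le_integral => //.
- by apply/measurable_EFinP/measurableT_comp => //; exact: measurable_funM.
- by apply/measurable_EFinP/measurableT_comp => //; exact: measurable_funM.
- apply: filterS rb => x rbx _.
  by rewrite lee_fin !normrM ler_wpM2r// (le_trans rbx)// ler_norm.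
Qed.

(** This also holds for f outside L^2: [fine] sends an infinite norm and an
    infinite integral both to 0. *)
Lemma L2norm_sqr f : L2norm mu f ^+ 2 = \int[mu]_x (f x ^+ 2).
Proof.
rewrite /L2norm unlock /Rintegral.
under eq_integral => x _ do
  rewrite /= powR_mulrn ?normr_ge0// real_normK ?num_real//.
have : (0 <= \int[mu]_x (f x ^+ 2)%:E)%E.
  by apply: integral_ge0 => x _; rewrite lee_fin sqr_ge0.
case: (\int[mu]_x _)%E => [a a0||//] /=.
  by rewrite powR12_sqrt// sqr_sqrtr.
by move=> _; rewrite invr_eq0 pnatr_eq0/= expr0n.
Qed.

Lemma L2norm_ge0 f : 0 <= L2norm mu f.
Proof. by rewrite /L2norm fine_ge0 ?Lnorm_ge0. Qed.

Lemma cauchy_schwarz f g : f \in Lfun mu 2%:E -> g \in Lfun mu 2%:E ->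
  `|Lpair mu f g| <= L2norm mu f * L2norm mu g.
Proof.
move=> f2 g2; have Ifg := L2_prod_integrable f2 g2.
have fin u : u \in Lfun mu 2%:E -> ('N[mu]_(2%:E) [EFin \o u])%E \is a fin_num.
  by case/andP => _ /[!inE] u2; rewrite ge0_fin_numE ?Lnorm_ge0.
rewrite -lee_fin EFin_normr_Rintegral// EFinM !fineK ?fin//.
apply: le_trans (le_abse_integral _ measurableT (measurable_int _ Ifg)) _.
rewrite -Lnorm1; apply: hoelder => //;
  [exact: Lfun_measurable f2|exact: Lfun_measurable g2|].
by rewrite [RHS]splitr !div1r.
Qed.

Lemma LpairC f g : Lpair mu f g = Lpair mu g f.
Proof. by apply: eq_Rintegral => x _; rewrite mulrC. Qed.

Lemma Lfun2_cst (c : R) : (mu setT < +oo)%E -> (fun=> c) \in Lfun mu 2%:E.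
Proof.
move=> mufin.
have one2 : (cst 1 : T -> R) \in Lfun mu 2%:E.
  apply/andP; split; rewrite inE //=.
  have := Lnorm_cst1 mu 2; rewrite /finite_norm => ->.
  exact: poweR_lty.
rewrite (_ : (fun=> c) = c \o* (cst 1 : T -> R)).
  by apply: Lfun_scale; rewrite // ler1n.
by apply/funext => x /=; rewrite mul1r.
Qed.

Lemma Lfun2_lin (a : R) f g : f \in Lfun mu 2%:E -> g \in Lfun mu 2%:E ->
  a \*o f \+ g \in Lfun mu 2%:E.
Proof.
have p1 : (1 <= 2%:E :> \bar R)%E by rewrite lee1n.
move=> f2 g2; exact: (Lfun_submod_closed mu p1).2.
Qed.

(** The smallest eigenvalue of the form a^2 + sqrt c * a * b + b^2. *)
Definition damping (c : R) : R := 1 - Num.sqrt c / 2.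

(** For a = sqrt g * y and b = sqrt r * x the right-hand side is
    a^2 + s a b + b^2 with s = sqrt (g r) <= sqrt c, and the form
    sqrt c * (a^2 + b^2) / 2 + s a b is nonnegative for 0 <= s <= sqrt c. *)
Lemma damped_young (g r b c x y : R) : 0 <= g -> 0 <= r <= b -> g * b <= c ->
  damping c * (g * y ^+ 2 + r * x ^+ 2)
    <= g * (y + r * x) * y + r * x * x.
Proof.
move=> g0 /andP[r0 rb] gbc.
have gr_le : Num.sqrt g * Num.sqrt r <= Num.sqrt c.
  rewrite -sqrtrM// ler_wsqrtr// (le_trans _ gbc)// ler_wpM2l//.
have sg0 := sqrtr_ge0 g; have sr0 := sqrtr_ge0 r.
have := sqr_sqrtr g0; have := sqr_sqrtr r0; rewrite /damping.
move: (Num.sqrt g) (Num.sqrt r) (Num.sqrt c) sg0 sr0 gr_le.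
move=> sg sr sc sg0 sr0 le_sc <- <-.
have sgsr : 0 <= sg * sr by rewrite mulr_ge0.
have H1 : 0 <= sg * sr * (sg * y + sr * x) ^+ 2 by rewrite mulr_ge0 ?sqr_ge0.
have H2 : 0 <= (sc - sg * sr) * ((sg * y) ^+ 2 + (sr * x) ^+ 2).
  by rewrite mulr_ge0 ?subr_ge0// addr_ge0 ?sqr_ge0.
rewrite -subr_ge0.
set e := (X in 0 <= X).
have -> : e = (sg * sr * (sg * y + sr * x) ^+ 2
   + (sc - sg * sr) * ((sg * y) ^+ 2 + (sr * x) ^+ 2)) / 2 by rewrite /e; lra.
by rewrite divr_ge0// addr_ge0.
Qed.

(** The pointwise bound [damped_young], integrated.  Since [Num.sqrt] vanishes
    on negative numbers, (sqrt (r x))^2 = r x holds only almost everywhere. *)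
Lemma penalty_coercive (g b c : R) (r f w : T -> R) :
  0 <= g -> g * b <= c -> measurable_fun setT r ->
  {ae mu, forall x, 0 <= r x <= b} ->
  f \in Lfun mu 2%:E -> w \in Lfun mu 2%:E ->
  damping c * (L2norm mu (fun x => Num.sqrt g * w x) ^+ 2
               + L2norm mu (fun x => Num.sqrt (r x) * f x) ^+ 2)
    <= Lpair mu (fun x => g * (w x + r x * f x)) w
       + Lpair mu (fun x => r x * f x) f.
Proof.
move=> g0 gbc mr rb f2 w2.
have r_le_b : {ae mu, forall x, `|r x| <= b}.
  by apply: filterS rb => x /andP[? ?]; rewrite ger0_norm.
have Iw := L2_prod_integrable w2 w2.
have Irf := ae_bounded_integrable mr r_le_b (L2_prod_integrable f2 f2).
have Irfw := ae_bounded_integrable mr r_le_b (L2_prod_integrable f2 w2).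
have I1 : mu.-integrable setT
    (EFin \o (fun x => g * (w x + r x * f x) * w x)).
  have := integrable_EFinZl g (integrable_EFinD Iw Irfw).
  by apply: eq_integrable => // x _ /=; congr EFin; lra.
have I2 : mu.-integrable setT (EFin \o (fun x => r x * f x * f x)).
  by apply: eq_integrable Irf => // x _ /=; rewrite mulrA.
rewrite !L2norm_sqr /Lpair.
rewrite (_ : \int[mu]_x _ = \int[mu]_x (g * (w x * w x))); last first.
  by apply: eq_Rintegral => x _; rewrite exprMn sqr_sqrtr.
rewrite (_ : \int[mu]_x _ ^+ 2 = \int[mu]_x (r x * (f x * f x))); last first.
  congr fine; apply: ae_eq_integral => //.
  - apply/measurable_EFinP/measurable_funX/measurable_funM.
      apply: measurableT_comp mr; apply: continuous_measurable_fun.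
      exact: sqrt_continuous.
    exact: Lfun_measurable f2.
  - exact: measurable_int Irf.
  - by apply: filterS rb => x /andP[r0 _] _; rewrite exprMn sqr_sqrtr.
have Igw : mu.-integrable setT (EFin \o (fun x => g * (w x * w x))).
  exact: (integrable_EFinZl g Iw).
have Igwrf : mu.-integrable setT
    (EFin \o (fun x => g * (w x * w x) + r x * (f x * f x))).
  exact: integrable_EFinD Igw Irf.
rewrite -!RintegralD// -RintegralZl//.
apply: ae_le_Rintegral.
- exact: (integrable_EFinZl (damping c) Igwrf).
- exact: integrable_EFinD I1 I2.
- by apply: filterS rb => x rbx; rewrite -!expr2; exact: damped_young rbx gbc.
Qed.

End Integration.

(** * The H^{1/2} norm modulo constants *)

Section Slobodeckij.
Context {d} {T : measurableType d} {R : realType}.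
Context (mu : {measure set T -> \bar R}) (dist : T -> T -> R).
Context (dist_ge0 : forall x y, 0 <= dist x y).
Implicit Types f w : T -> R.

Lemma slobodeckij2_ge0 w : (0 <= slobodeckij2 mu dist w)%E.
Proof.
apply: integral_ge0 => x _; apply: integral_ge0 => y _.
by rewrite lee_fin divr_ge0 ?sqr_ge0 ?exprn_ge0.
Qed.

Lemma slobodeckij2_shift (c : R) w :
  slobodeckij2 mu dist (c \*o (fun=> 1) \+ w) = slobodeckij2 mu dist w.
Proof.
rewrite /slobodeckij2; apply: eq_integral => x _; apply: eq_integral => y _ /=.
by congr ((_ ^+ 2 / _)%:E); lra.
Qed.

Lemma slobodeckij2_cst (c : R) : slobodeckij2 mu dist (fun=> c) = 0%E.
Proof.
rewrite /slobodeckij2 integral0_eq// => x _; rewrite integral0_eq// => y _.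
by rewrite subrr expr0n mul0r.
Qed.

Lemma in_Hhalf_cst (c : R) : (mu setT < +oo)%E -> in_Hhalf mu dist (fun=> c).
Proof. by move=> mufin; split; [exact: Lfun2_cst | rewrite slobodeckij2_cst]. Qed.

Lemma in_Hhalf_shift (c : R) w : (mu setT < +oo)%E -> in_Hhalf mu dist w ->
  in_Hhalf mu dist (c \*o (fun=> 1) \+ w).
Proof.
move=> mufin [w2 sw]; split; last by rewrite slobodeckij2_shift.
by apply: Lfun2_lin => //; exact: Lfun2_cst.
Qed.

Lemma Hhalf_norm_sqr w :
  Hhalf_norm mu dist w ^+ 2 = L2norm mu w ^+ 2 + fine (slobodeckij2 mu dist w).
Proof. by rewrite sqr_sqrtr// addr_ge0 ?sqr_ge0// fine_ge0// slobodeckij2_ge0. Qed.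

Lemma L2norm_le_Hhalf w : L2norm mu w <= Hhalf_norm mu dist w.
Proof.
rewrite -ler_sqr ?nnegrE ?L2norm_ge0 ?sqrtr_ge0// Hhalf_norm_sqr lerDl.
by rewrite fine_ge0 ?slobodeckij2_ge0.
Qed.

(** Cauchy-Schwarz, as the L^2 norm is part of the H^{1/2} norm. *)
Lemma Lpair_Hmhalf f : f \in Lfun mu 2%:E -> in_Hmhalf mu dist (Lpair mu f).
Proof.
move=> f2; split=> [a w v [w2 _] [v2 _]|].
  have Iw := L2_prod_integrable f2 w2; have Iv := L2_prod_integrable f2 v2.
  rewrite /Lpair -RintegralZl// -RintegralD//; last first.
    exact: (integrable_EFinZl a Iw).
  by apply: eq_Rintegral => x _ /=; rewrite mulrDr mulrCA.
exists (L2norm mu f) => v [v2 _]; apply: le_trans (cauchy_schwarz f2 v2) _.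
by rewrite ler_wpM2l ?L2norm_ge0 ?L2norm_le_Hhalf.
Qed.

Lemma exists_mean_zero_shift w : (mu setT < +oo)%E -> w \in Lfun mu 2%:E ->
  exists c : R, \int[mu]_x (c \*o (fun=> 1) \+ w) x = 0.
Proof.
move=> mufin w2.
have I1 : mu.-integrable setT (EFin \o w).
  have := L2_prod_integrable (Lfun2_cst 1 mufin) w2.
  by apply: eq_integrable => // x _ /=; rewrite mul1r.
have Ic (c : R) : mu.-integrable setT (EFin \o (fun=> c)).
  have := L2_prod_integrable (Lfun2_cst c mufin) (Lfun2_cst 1 mufin).
  by apply: eq_integrable => // x _ /=; rewrite mulr1.
have [mu0|mu_neq0] := eqVneq (fine (mu setT)) 0.
  (* Every integral with respect to the zero measure vanishes. *)
  exists 0; rewrite /Rintegral null_set_integral//.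
  - apply/measurable_EFinP/measurable_funD; last exact: Lfun_measurable w2.
    exact: measurable_funM.
  - by rewrite -[LHS]fineK ?ge0_fin_numE// mu0.
exists (- (\int[mu]_x w x) / fine (mu setT)).
under eq_Rintegral => x _ do rewrite /= mulr1.
by rewrite RintegralD// Rintegral_cst// divfK// addNr.
Qed.

(** Ellipticity on the mean-zero functions suffices: for a constant c such that
    u = w + c has mean zero, Q u u = Q w w by symmetry and because Q annihilates
    constants, and u has the Slobodeckij seminorm of w.  The L^2 part of the
    norm of u is dropped, and that of w is what the right-hand side adds. *)
Lemma Hhalf_coercive_modulo_L2 (Q : (T -> R) -> (T -> R) -> R) (cD : R) w :
  (mu setT < +oo)%E -> 0 < cD ->
  (forall (a : R) u u' v, in_Hhalf mu dist u -> in_Hhalf mu dist u' ->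
     in_Hhalf mu dist v -> Q (a \*o u \+ u') v = a * Q u v + Q u' v) ->
  (forall u v, in_Hhalf mu dist u -> in_Hhalf mu dist v -> Q u v = Q v u) ->
  (forall v, in_Hhalf mu dist v -> Q (fun=> 1) v = 0) ->
  (forall u, in_Hhalf mu dist u -> \int[mu]_x u x = 0 ->
     cD * Hhalf_norm mu dist u ^+ 2 <= Q u u) ->
  in_Hhalf mu dist w ->
  cD * Hhalf_norm mu dist w ^+ 2 <= Q w w + cD * L2norm mu w ^+ 2.
Proof.
move=> mufin cD0 Qlin Qsym Q1 Qcoer Hw.
have [c mean0] := exists_mean_zero_shift mufin Hw.1.
have H1 := in_Hhalf_cst 1 mufin.
have Hu := in_Hhalf_shift c mufin Hw.
have shiftQ v : in_Hhalf mu dist v -> Q (c \*o (fun=> 1) \+ w) v = Q w v.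
  by move=> Hv; rewrite Qlin// Q1// mulr0 add0r.
have := Qcoer _ Hu mean0.
(* Q u u = Q w u = Q u w = Q w w *)
rewrite shiftQ// Qsym// shiftQ//.
rewrite !Hhalf_norm_sqr slobodeckij2_shift.
have := mulr_ge0 (ltW cD0) (sqr_ge0 (L2norm mu (c \*o (fun=> 1) \+ w))).
by rewrite !mulrDr; lra.
Qed.

End Slobodeckij.

(** * Finiteness of the surface measure *)

Section Surface.
Context {R : realType}.

Lemma lebesgue2_ref_triangle_fin : (lebesgue2 R ref_triangle < +oo)%E.
Proof.
have sub : @ref_triangle R `<=` `[0%R, 1%R]%classic `*` `[0%R, 1%R]%classic.
  move=> u /andP[/andP[u1 u2] u12]; rewrite /= !in_itv/=; split; lra.
apply: (@le_lt_trans _ _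
  (lebesgue2 R (`[0%R, 1%R]%classic `*` `[0%R, 1%R]%classic))).
  apply: le_measure => //.
- by rewrite inE; exact: measurable_ref_triangle.
- by rewrite inE; apply: measurableX; exact: measurable_itv.
- rewrite product_measure1E; [|exact: measurable_itv..].
  rewrite [X in (X * _)%E]lebesgue_measure_itv.
  rewrite [X in (_ * X)%E]lebesgue_measure_itv /=.
  by rewrite lte01 !sube0 mule1 ltry.
Qed.

Lemma surface_measure_fin (m : seq (panel R)) :
  (surface_measure m setT < +oo)%E.
Proof.
rewrite /surface_measure /msum; apply: lte_sum_pinfty => k _.
set T := nth _ _ _.
have -> : panel_measure T setT =
    ((eucl_norm (area_vec T))%:E * lebesgue2 R ([set: R * R] `&` ref_triangle))%E.
  by [].
rewrite setTI lte_mul_pinfty ?lee_fin ?eucl_norm_ge0//.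
exact: lebesgue2_ref_triangle_fin.
Qed.

End Surface.

(** * The coercivity constant *)

Lemma damping_gt0 {R : realType} (c : R) : c < 4 -> 0 < damping c.
Proof.
move=> c4; rewrite /damping.
have : Num.sqrt c < 2.
  rewrite (_ : 2 = Num.sqrt (2 ^+ 2)); last by rewrite sqrtr_sqr ger0_norm.
  by rewrite ltr_sqrt; lra.
lra.
Qed.

(** Only a fraction t <= 1 of ED is used for n2, small enough for its defect
    t cD l2 <= t cD b n3^2 to be absorbed by half of the penalty energy; the
    remaining (1 - t) ED is nonnegative.  The factor 4 below comes from the
    square of a sum of four terms.  The constant is chosen before the norms and
    energies, which is the uniformity in the mesh size. *)
Lemma coercivity_constant {R : realType} (cV cD k b : R) :
  0 < cV -> 0 < cD -> 0 < k -> 0 < b ->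
  exists2 alpha : R, 0 < alpha & forall n1 n2 n3 n4 l2 EV ED EB : R,
    cV * n1 ^+ 2 <= EV -> 0 <= ED ->
    cD * n2 ^+ 2 <= ED + cD * l2 -> l2 <= b * n3 ^+ 2 ->
    k * (n3 ^+ 2 + n4 ^+ 2) <= EB ->
    alpha * (n1 + n2 + n3 + n4) ^+ 2 <= EV + ED + EB.
Proof.
move=> cV0 cD0 k0 b0.
have bcD0 : 0 < cD * b by rewrite mulr_gt0.
pose t := Num.min 1 (k / 2 / (cD * b)).
have t0 : 0 < t by rewrite lt_min ltr01 !divr_gt0.
have t1 : t <= 1 by rewrite ge_min lexx.
have tk : t * (cD * b) <= k / 2.
  by rewrite -ler_pdivlMr// ge_min lexx orbT.
pose a := Num.min cV (Num.min (t * cD) (k / 2)).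
have a0 : 0 < a by rewrite !lt_min cV0 divr_gt0// mulr_gt0.
have aV : a <= cV by rewrite ge_min lexx.
have aD : a <= t * cD by rewrite !ge_min lexx orbT.
have ak : a <= k / 2 by rewrite !ge_min lexx !orbT.
exists (a / 4); first by rewrite divr_gt0.
move=> n1 n2 n3 n4 l2 EV ED EB hV hD0 hD hl hB.
have sq4 : (n1 + n2 + n3 + n4) ^+ 2 <= 4 * (n1 ^+ 2 + n2 ^+ 2 + n3 ^+ 2 + n4 ^+ 2).
  have := sqr_ge0 (n1 - n2); have := sqr_ge0 (n1 - n3); have := sqr_ge0 (n1 - n4).
  have := sqr_ge0 (n2 - n3); have := sqr_ge0 (n2 - n4); have := sqr_ge0 (n3 - n4).
  lra.
have h1 := ler_wpM2l (ltW a0) sq4.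
have h2 := ler_wpM2r (sqr_ge0 n1) aV.
have h3 := ler_wpM2r (sqr_ge0 n2) aD.
have h4 := ler_wpM2r (sqr_ge0 n3) ak.
have h5 := ler_wpM2r (sqr_ge0 n4) ak.
have h6 := ler_wpM2r hD0 t1.
have h7 := ler_wpM2l (ltW t0) hD.
have h8 := ler_wpM2l (mulr_ge0 (ltW t0) (ltW cD0)) hl.
have h9 := ler_wpM2r (sqr_ge0 n3) tk.
have h10 := mulr_ge0 (ltW k0) (sqr_ge0 n4).
lra.
Qed.

Theorem lemmaA2 (R : realType)
  (* the domain, and for each mesh size h: the polyhedral domain, its surface
     triangulation, the distance function, the penalty and the operators *)
  (Om : set (pt R)) (h0 : R) (Omh : R -> set (pt R)) (mesh : R -> seq (panel R))
  (rho : R -> pt R -> R) (gamma : R -> R)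
  (V : R -> ((pt R -> R) -> R) -> pt R -> R)
  (D : R -> (pt R -> R) -> (pt R -> R) -> R)
  (* constants independent of h *)
  (kappa q Crho tau Cray alow aup L Ch : R) (nch : nat)
  (CV CK CK' CD cV cD cgm cgp c0 : R) :
  (* domain *)
  domain Om -> bounded_set Om -> smooth_boundary Om -> connected (bdry Om) ->
  0 < h0 -> tubular_width Om tau -> Crho * h0 < tau ->
  (* polyhedral approximations *)
  (forall h, 0 < h <= h0 ->
    [/\ domain (Omh h), bounded_set (Omh h), Omh h `<=` Om,
        connected (bdry (Omh h)) & bdry (Omh h) `<=` closure Om]) ->
  (forall h, 0 < h <= h0 ->
    [/\ triangulates (Omh h) (mesh h), mesh_size (mesh h) = h,
        shape_regular kappa (mesh h) & quasiuniform q (mesh h)]) ->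
  (forall h, 0 < h <= h0 ->
    normal_projection Om (mesh h) (rho h) /\
    delta (mesh h) (rho h) <= Crho * h) ->
  (forall h, 0 < h <= h0 -> lipschitz_charts nch L Ch (mesh h)) ->
  0 < alow ->
  (forall h, 0 < h <= h0 ->
    (alow%:E <= surface_measure (mesh h) (surface (mesh h)) <= aup%:E)%E) ->
  (forall h, 0 < h <= h0 -> ray_overlap Om (mesh h) (rho h) Cray) ->
  (* boundary integral operators *)
  (forall h, 0 < h <= h0 ->
    [/\ extends_single_layer (mesh h) (V h),
        is_hypersingular (mesh h) (Omh h) (D h),
        symmetric_D (mesh h) (D h), nonneg_D (mesh h) (D h) &
        kernel_D (mesh h) (D h)]) ->
  (forall h, 0 < h <= h0 ->
    [/\ bounded_V (mesh h) (V h) CV, bounded_D (mesh h) (D h) CD,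
        bounded_K (mesh h) CK & bounded_K' (mesh h) CK']) ->
  0 < cV ->
  (forall h, 0 < h <= h0 -> forall l, Hmhalf (mesh h) l ->
    cV * normHm (mesh h) l ^+ 2 <= l (V h l)) ->
  0 < cD ->
  (forall h, 0 < h <= h0 -> forall w, Hhalf (mesh h) w ->
    \int[surface_measure (mesh h)]_x w x = 0 ->
    cD * normH (mesh h) w ^+ 2 <= D h w w) ->
  (* penalty *)
  0 < cgm -> 0 < cgp -> 0 < c0 < 4 ->
  (forall h, 0 < h <= h0 ->
    cgm * h^-1 <= gamma h <= cgp * h^-1 /\
    gamma h * delta (mesh h) (rho h) <= c0) ->
  exists2 alpha : R, 0 < alpha &
    forall h, 0 < h <= h0 -> forall p, in_Vtilde (mesh h) p ->
      alpha * normB (mesh h) (gamma h) (rho h) p ^+ 2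
        <= formA (mesh h) (V h) (D h) (gamma h) (rho h) p p.
Proof.
move=> _ _ _ _ h0gt0 _ _ _ _ proj _ _ _ _ opD bounded cV0 Vcoer cD0 Dcoer.
move=> cgm0 _ /andP[_ c04] penalty.
have [alpha alpha0 combine] := coercivity_constant cV0 cD0 (damping_gt0 c04)
  (divr_gt0 h0gt0 cgm0).
exists alpha => // h hh [lam w] [lam2 Hw].
have /andP[h_gt0 h_le] := hh.
have [[rhoy rho_ae] _] := proj h hh.
have [_ _ Dsym Dge0 Dker] := opD h hh.
have [_ [_ Dlin _] _ _] := bounded h hh.
have [/andP[g_ge _] gdelta] := penalty h hh.
have mufin := surface_measure_fin (mesh h).
have dist0 (x y : pt R) : 0 <= eucl_dist x y by exact: eucl_norm_ge0.
have g_cgm : cgm <= h0 * gamma h.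
  rewrite -ler_pdivrMl// mulrC (le_trans _ g_ge)// ler_wpM2l ?(ltW cgm0)//.
  by rewrite lef_pV2.
have g0 : 0 <= gamma h by rewrite (le_trans _ g_ge)// divr_ge0 ?ltW.
have D1 v : Hhalf (mesh h) v -> D h (fun=> 1) v = 0.
  have [_ Dker1] := Dker _ (in_Hhalf_cst eucl_dist 1 mufin).
  by apply: Dker1; exists 1; exact: aeW.
have rho_ae' : {ae surface_measure (mesh h), forall x,
    0 <= rho h x <= delta (mesh h) (rho h)} by apply: filterS rho_ae => x [].
have -> : formA (mesh h) (V h) (D h) (gamma h) (rho h) (lam, w) (lam, w) =
    Lpair (surface_measure (mesh h)) lam
      (V h (Lpair (surface_measure (mesh h)) lam)) + D h w w +
    (Lpair (surface_measure (mesh h))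
       (fun x => gamma h * (w x + rho h x * lam x)) w +
     Lpair (surface_measure (mesh h)) (fun x => rho h x * lam x) lam).
  by rewrite /formA /formC /formBD /= /opK' (LpairC _ w lam); lra.
apply: (combine _ _ _ _ (L2norm (surface_measure (mesh h)) w ^+ 2)).
- exact/Vcoer/Lpair_Hmhalf.
- exact: Dge0.
- exact: (Hhalf_coercive_modulo_L2 dist0 mufin cD0 Dlin Dsym D1 (Dcoer h hh)).
- rewrite !L2norm_sqr.
  under [X in _ <= _ * X]eq_Rintegral => x _ do rewrite exprMn sqr_sqrtr//.
  rewrite RintegralZl//; last exact: Lfun2_integrable_sqr Hw.1.
  rewrite mulrA ler_peMl ?Rintegral_ge0// => [x _|]; first exact: sqr_ge0.
  by rewrite mulrAC ler_pdivlMr// mul1r.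
- exact: penalty_coercive gdelta (Lfun_measurable rhoy) rho_ae' lam2 Hw.1.
Qed.
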